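(* Let $(\mathbb T,d)$ be a locally compact, separable metric space and let $\mu$ be a finite Borel measure supported on a compact subset of $\mathbb T$. If $f_n$ hypi-converges to $f$ in $\ell^\infty_{\mathrm{loc}}(\mathbb T)$ and if $f$ is continuous $\mu$-almost everywhere, then, for every $p\in[1,\infty)$, we have $$\int|f_{n,\vee}-f_{n,\wedge}|^p\,d\mu\to0\quad\text{and}\quad\int|f_n^*-f^*|^p\,d\mu\to0,\qquad n\to\infty,$$ where $f_n^*$ and $f^*$ represent arbitrary Borel measurable functions on $\mathbb T$ such that $f_{n,\wedge}\le f_n^*\le f_{n,\vee}$ and $f_\wedge\le f^*\le f_\vee$.
   Context: $\ell^\infty_{\mathrm{loc}}(\mathbb T)$ is the set of functions $f:\mathbb T\to\mathbb R$ that are bounded on compact subsets of $\mathbb T$. For such $f$, $f_\wedge(x)=\sup_{\varepsilon>0}\inf\{f(x'):d(x',x)<\varepsilon\}$ and $f_\vee(x)=\inf_{\varepsilon>0}\sup\{f(x'):d(x',x)<\varepsilon\}$ (lower and upper semicontinuous hulls); $f_{n,\wedge}=(f_n)_\wedge$ and $f_{n,\vee}=(f_n)_\vee$. A sequence $f_n\in\ell^\infty_{\mathrm{loc}}(\mathbb T)$ hypi-converges to $f\in\ell^\infty_{\mathrm{loc}}(\mathbb T)$ if $f_n$ epi-converges to $f_\wedge$ and hypo-converges to $f_\vee$, i.e. if for every $x\in\mathbb T$: (a) for all sequences $x_n\to x$, $f_\wedge(x)\le\liminf_nf_n(x_n)$ and $\limsup_nf_n(x_n)\le f_\vee(x)$;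 (b) there exists a sequence $x_n\to x$ with $\limsup_nf_n(x_n)\le f_\wedge(x)$; (c) there exists a sequence $x_n\to x$ with $\liminf_nf_n(x_n)\ge f_\vee(x)$. *)

(* Defs.v *)
From HB Require Import structures.
From mathcomp Require Import all_boot all_order all_algebra.
From mathcomp Require Import all_classical all_reals all_analysis.

Set Implicit Arguments.
Unset Strict Implicit.
Unset Printing Implicit Defensive.

Import Order.TTheory GRing.Theory Num.Theory.
Import numFieldNormedType.Exports.

Local Open Scope classical_set_scope.
Local Open Scope ring_scope.

(* Every measurableType is pointed, so a space that is to carry a measure has
   to come with a point; for a metric space this only excludes the empty one. *)
#[short(type="pmetricType")]
HB.structure Definition PointedMetric (K : numDomainType) :=
  { T of Pointed T & Metric K T }.

Definition separable (T : topologicalType) : Prop :=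
  exists2 S : set T, countable S & dense S.

(* T equipped with its Borel sigma-algebra. *)
Notation borel T := (g_sigma_algebraType (@open T)).

Section Hypi.
Context {R : realType} {T : pmetricType R}.
Implicit Types (f : T -> R) (fn : nat -> T -> R) (g : T -> \bar R) (x : T).
Local Open Scope ereal_scope.

Definition linf_loc : set (T -> R) :=
  [set f | forall K : set T, compact K -> [bounded f y | y in K]].

(* The hulls are extended real-valued because f may be unbounded on large balls
   even if it is bounded on compact sets. *)
Definition lsc_hull f x : \bar R :=
  ereal_sup [set ereal_inf [set (f x')%:E | x' in [set x' | (mdist x' x < e)%R]]
            | e in [set e : R | (0 < e)%R]].

Definition usc_hull f x : \bar R :=
  ereal_inf [set ereal_sup [set (f x')%:E | x' in [set x' | (mdist x' x < e)%R]]
            | e in [set e : R | (0 < e)%R]].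

Definition epi_cvg fn g : Prop := forall x,
  (forall xn : nat -> T, xn @ \oo --> x ->
     g x <= limn_einf (fun n => (fn n (xn n))%:E)) /\
  (exists2 xn : nat -> T, xn @ \oo --> x &
     limn_esup (fun n => (fn n (xn n))%:E) <= g x).

Definition hypo_cvg fn g : Prop := forall x,
  (forall xn : nat -> T, xn @ \oo --> x ->
     limn_esup (fun n => (fn n (xn n))%:E) <= g x) /\
  (exists2 xn : nat -> T, xn @ \oo --> x &
     g x <= limn_einf (fun n => (fn n (xn n))%:E)).

Definition hypi_cvg fn f : Prop :=
  epi_cvg fn (lsc_hull f) /\ hypo_cvg fn (usc_hull f).

End Hypi.

(* Main.v *)
(* Applied along sequences, the upper halves of epi- and hypo-convergence
   upgrade to locally uniform one-sided bounds: if the upper hull of f at x is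
   below c, then f_n <= c on a fixed ball around x for all large n, hence so is
   the upper hull of f_n; lower hulls follow by passing to -f. By compactness
   the hulls of f_n are eventually uniformly bounded on the support of mu, and
   at a continuity point of f they squeeze to f(x), so bounded convergence
   concludes. *)

Require Import Defs.
From HB Require Import structures.
From mathcomp Require Import all_boot all_order all_algebra.
From mathcomp Require Import all_classical all_reals all_analysis.
From mathcomp Require Import measurable_realfun.

Set Implicit Arguments.
Unset Strict Implicit.
Unset Printing Implicit Defensive.

Import Order.TTheory GRing.Theory Num.Theory.
Import numFieldNormedType.Exports.

Local Open Scope classical_set_scope.
Local Open Scope ring_scope.

(** * Semicontinuous hulls and one-sided local bounds *)

Section Hulls.
Context {R : realType} {T : pmetricType R}.
Implicit Types (f : T -> R) (fn : nat -> T -> R) (x : T) (c : \bar R).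

(** An infimum below [c] is beaten by one of its members, so some ball has supremum [s < c]; this
    trades radii for the neighbourhood filter. *)
Lemma usc_hull_ltP f x c : (usc_hull f x < c)%E <->
  exists2 s, (s < c)%E & \forall y \near x, ((f y)%:E <= s)%E.
Proof.
split=> [/ereal_inf_lt[_ [e /= e0 <-] sc]|[s sc /nbhs_ballP[e /= e0 es]]].
  eexists; first exact: sc.
  apply/nbhs_ballP; exists e => //= y; rewrite ballEmdist/= metric_sym => yx.
  by apply: ereal_sup_ubound; exists y.
apply: le_lt_trans sc; apply: le_trans (ereal_inf_lbound _) _.
  by exists e => //=; reflexivity.
apply: ge_ereal_sup => _ [y /= yx <-]; apply: es.
by rewrite ballEmdist/= metric_sym.
Qed.

Lemma usc_hull_le f x c :
  (\forall y \near x, ((f y)%:E <= c)%E) -> (usc_hull f x <= c)%E.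
Proof.
move=> fc; rewrite leNgt; apply/negP => cf.
suff : (usc_hull f x < usc_hull f x)%E by rewrite ltxx.
by apply/usc_hull_ltP; exists c.
Qed.

Lemma usc_hull_ge f x : ((f x)%:E <= usc_hull f x)%E.
Proof.
rewrite leNgt; apply/negP => /usc_hull_ltP[s sf /nbhs_singleton].
by rewrite leNgt sf.
Qed.

Lemma open_usc_hull_lt f c : open [set x | (usc_hull f x < c)%E].
Proof.
rewrite openE => x /= /usc_hull_ltP[s sc /nbhs_interior].
by apply: filterS => y /= ys; apply/usc_hull_ltP; exists s.
Qed.

(** Through this reflection, lower hulls are handled by applying the upper-hull facts to [\- f]. *)
Lemma lsc_hullE f x : lsc_hull f x = (- usc_hull (\- f)%R x)%E.
Proof.
rewrite /lsc_hull /usc_hull ereal_infEN oppeK; congr ereal_sup.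
rewrite image_comp; apply: eq_imagel => e e0 /=.
rewrite ereal_infEN; congr (- ereal_sup _)%E.
by rewrite image_comp; apply: eq_imagel => y _ /=.
Qed.

Lemma lsc_hull_le f x : (lsc_hull f x <= (f x)%:E)%E.
Proof. by rewrite lsc_hullE leeNl -EFinN usc_hull_ge. Qed.

(** Open rays unbounded below generate the Borel sets of [\bar R], and their preimages are open. *)
Lemma measurable_usc_hull f :
  measurable_fun [set: borel T] (usc_hull f).
Proof.
apply: (measurability _ (ErealGenInftyO.measurableE R)) => _ [_ [r ->] <-].
rewrite setTI; apply: sub_sigma_algebra.
rewrite (_ : _ @^-1` _ = [set x | (usc_hull f x < r%:E)%E]).
  exact: open_usc_hull_lt.
by apply/seteqP; split=> x /=; rewrite in_itv.
Qed.

Lemma measurable_lsc_hull f :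
  measurable_fun [set: borel T] (lsc_hull f).
Proof.
rewrite (_ : lsc_hull f = fun x => (- usc_hull (\- f)%R x)%E); last first.
  by apply/funext => x; exact: lsc_hullE.
by apply: measurableT_comp => //; exact: measurable_usc_hull.
Qed.

(** Local compactness supplies a compact neighbourhood of [x], on which [f] is bounded. *)
Lemma usc_hull_lty f x : locally_compact [set: T] -> linf_loc f ->
  (usc_hull f x < +oo)%E.
Proof.
move=> /(_ x I)[K + [cK _]] /(_ K cK)/pinfty_ex_gt0[M _ /= fM].
rewrite withinET => xK.
apply/usc_hull_ltP; exists M%:E; first exact: ltry.
apply: filterS xK => y /fM /=; rewrite lee_fin; exact: le_trans (ler_norm _).
Qed.

Lemma linf_locN f : linf_loc f -> linf_loc (\- f).
Proof.
move=> fl K cK; have := fl K cK; rewrite /bounded_near.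
by apply: (@filterS _ +oo%R) => M fM x Kx; rewrite /= normrN; exact: fM.
Qed.

Lemma usc_hull_fin f x : locally_compact [set: T] -> linf_loc f ->
  usc_hull f x \is a fin_num.
Proof.
move=> Tlc fl; rewrite fin_real// usc_hull_lty// andbT.
by apply: lt_le_trans (usc_hull_ge f x); exact: ltNyr.
Qed.

Lemma lsc_hull_fin f x : locally_compact [set: T] -> linf_loc f ->
  lsc_hull f x \is a fin_num.
Proof.
by move=> Tlc fl; rewrite lsc_hullE fin_numN usc_hull_fin//; exact: linf_locN.
Qed.

Lemma usc_hull_continuous f x : {for x, continuous f} ->
  usc_hull f x = (f x)%:E.
Proof.
move=> fx; apply/eqP; rewrite eq_le usc_hull_ge andbT.
apply/lee_addgt0Pr => e e0; apply: usc_hull_le.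
have : \forall y \near x, f y < f x + e.
  by apply: (cvgr_lt (f x)) => //; rewrite ltrDl.
by apply: filterS => y /ltW; rewrite -EFinD lee_fin.
Qed.

Lemma lsc_hull_continuous f x : {for x, continuous f} ->
  lsc_hull f x = (f x)%:E.
Proof.
move=> fx; rewrite lsc_hullE (@usc_hull_continuous (\- f)) ?oppeK//.
  by rewrite EFinN oppeK.
exact: continuousN.
Qed.

(** The product filter asks for one neighbourhood and one index threshold valid jointly; this
    uniformity is what lets the bound pass to hulls. *)
Definition usc_dominated fn f := forall x c, (usc_hull f x < c)%E ->
  \forall y \near x & n \near \oo, ((fn n y)%:E <= c)%E.

Lemma usc_dominated_cst f : usc_dominated (fun=> f) f.
Proof.
move=> x c /usc_hull_ltP[s sc xs].
exists ([set y | ((f y)%:E <= s)%E], setT); first by split=> //=; exact: filterT.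
by move=> [y n] [/= ys _]; exact: le_trans ys (ltW sc).
Qed.

(* If the bound failed, points violating it at ever larger indices and ever
   smaller radii, completed by x itself, would form a sequence xn --> x whose
   limsup is at least c. *)
Lemma limsup_usc_dominated fn f :
  (forall x (xn : nat -> T), xn @ \oo --> x ->
     (limn_esup (fun n => (fn n (xn n))%:E) <= usc_hull f x)%E) ->
  usc_dominated fn f.
Proof.
move=> H x c fxc; apply: contrapT => Nxc.
have /choice[q qP] : forall k : nat, exists ny : nat * T,
    [/\ (k <= ny.1)%N, ball x (k.+1%:R^-1) ny.2 & (c < (fn ny.1 ny.2)%:E)%E].
  move=> k; apply: contrapT => Nk; apply: Nxc.
  exists (ball x (k.+1%:R^-1), [set n | (k <= n)%N]).
    split=> /=; last by exists k.
    by apply: nbhsx_ballx; rewrite invr_gt0.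
  move=> [y n] [/= xy kn]; rewrite leNgt; apply/negP => cf.
  by apply: Nk; exists (n, y).
pose xn n := if pselect (exists k, (q k).1 = n) is left P
  then (q (projT1 (cid P))).2 else x.
have xnx : xn @ \oo --> x.
  apply/cvg_ballP => e e0.
  have := near_infty_natSinv_lt (PosNum e0); move=> [K _ Ke].
  (* An index [n] above this sum can equal [(q k).1] only for [k >= K], which puts its point in a
     ball of radius below [e]. *)
  exists (\sum_(k < K) (q k).1).+1 => // n /= nK.
  rewrite /xn; case: pselect => [P|_]; last exact: ballxx.
  case: cid => k /= kn; have [_ kx _] := qP k.
  apply: le_ball kx; apply/ltW/Ke => /=; rewrite leqNgt; apply/negP => kK.
  move: nK; rewrite -kn (bigD1 (Ordinal kK))//=.
  by rewrite ltnNge leq_addr.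
have := H x xn xnx; rewrite leNgt => /negP; apply.
apply: (lt_le_trans fxc); apply: le_ereal_inf_tmp => _ [V [N _ NV] <-].
(* The index [(q N).1] lies in the tail [V]; whichever [k] with that index [cid] returns, the value
   there exceeds [c]. *)
have [Nq _ _] := qP N; apply: le_trans (ereal_sup_ubound _); last first.
  by exists (q N).1 => //; exact: NV.
rewrite /= /xn; case: pselect => [P|[]]; last by exists N.
by case: cid => k /= <-; have [_ _ /ltW] := qP k.
Qed.

(** A point of the interior of [A] has [A] as a neighbourhood, so the bound on [A] passes to the
    hull there. *)
Lemma usc_dominated_hull fn f x c : usc_dominated fn f -> (usc_hull f x < c)%E ->
  \forall y \near x & n \near \oo, (usc_hull (fn n) y <= c)%E.
Proof.
move=> H /H[[A B] /= [xA ooB] AB].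
exists (A°, B); first by split=> //=; exact: nbhs_interior.
move=> [y n] [/= Ay Bn]; apply: usc_hull_le.
by apply: filterS Ay => z Az; exact: (AB (z, n)).
Qed.

Lemma usc_hull_bounded fn f (K : set T) : locally_compact [set: T] ->
  linf_loc f -> usc_dominated fn f -> compact K ->
  exists M : R, \forall n \near \oo, forall x, K x ->
    (usc_hull (fn n) x <= M%:E)%E.
Proof.
move=> Tlc fl H /compact_near_coveringP cK.
(* A single [k] is both index threshold and bound, so near-covering compactness along [\oo] yields
   one [k] for all of [K]. *)
pose P k y := forall n, (k <= n)%N -> (usc_hull (fn n) y <= k%:R%:E)%E.
have [k _ kP] : \forall k \near \oo, K `<=` P k.
  apply: cK => x _.
  have fx : usc_hull f x = (fine (usc_hull f x))%:E.
    by rewrite fineK// usc_hull_fin.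
  have : (usc_hull f x < (fine (usc_hull f x) + 1)%:E)%E.
    by rewrite {1}fx lte_fin ltrDl.
  move=> /(usc_dominated_hull H)[[A B] /= [xA [N _ NB]] AB].
  exists (A, [set k | (N <= k)%N /\ fine (usc_hull f x) + 1 <= k%:R]).
    split=> //=; apply: filterI; first by exists N.
    exact: nbhs_infty_ger.
  move=> [y k] [/= Ay [Nk fk]] n kn.
  apply: le_trans (AB (y, n) _) _; last by rewrite lee_fin.
  by split=> //=; apply: NB; exact: leq_trans kn.
exists k%:R; exists k => // n kn x Kx.
by apply: (kP k) => //=.
Qed.

End Hulls.

(** * Two-sided bounds and limits from hypi-convergence *)

Section HypiConvergence.
Context {R : realType} {T : pmetricType R}.
Implicit Types (f : T -> R) (fn : nat -> T -> R) (x : T).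

(** Lower control is encoded as upper control of the negatives, so each one-sided result can be used
    twice. *)
Definition hypi_dominated fn f :=
  usc_dominated fn f /\ usc_dominated (fun n => \- fn n) (\- f).

(** Makes the bounds below available for functions between the hulls of [f] itself. *)
Lemma hypi_dominated_cst f : hypi_dominated (fun=> f) f.
Proof. by split; exact: usc_dominated_cst. Qed.

Lemma hypi_cvg_dominated fn f : hypi_cvg fn f -> hypi_dominated fn f.
Proof.
move=> [epi hypo]; split; apply: limsup_usc_dominated => x xn xnx.
  by have [/(_ xn xnx)] := hypo x.
have [/(_ xn xnx) + _] := epi x.
by rewrite lsc_hullE /limn_einf leeN2.
Qed.

(** Allowing any [a] between the hulls covers the two hulls and the arbitrary [fns n] at once. *)
Lemma hull_between_bounded fn f (K : set T) : locally_compact [set: T] ->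
  linf_loc f -> hypi_dominated fn f -> compact K ->
  exists M : R, \forall n \near \oo, forall x (a : R), K x ->
    (lsc_hull (fn n) x <= a%:E <= usc_hull (fn n) x)%E -> `|a| <= M.
Proof.
move=> Tlc fl [fU fL] cK.
have [M1 HM1] := usc_hull_bounded Tlc fl fU cK.
have [M2 HM2] := usc_hull_bounded Tlc (linf_locN fl) fL cK.
exists (Num.max M1 M2); apply: filterS2 HM1 HM2 => n H1 H2 x a Kx /andP[].
rewrite lsc_hullE leeNl => /le_trans/(_ (H2 x Kx)) + /le_trans/(_ (H1 x Kx)).
rewrite -EFinN !lee_fin => aM2 aM1.
by rewrite ler_norml lerNl !le_max aM1 aM2 orbT.
Qed.

(** The upper hulls of [f] and [\- f] at a continuity point are [f x] and [- f x], which squeezes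
    [a n] from both sides. *)
Lemma hull_between_cvg fn f x (a : nat -> R) : hypi_dominated fn f ->
  {for x, continuous f} ->
  (forall n, (lsc_hull (fn n) x <= (a n)%:E <= usc_hull (fn n) x)%E) ->
  a @ \oo --> f x.
Proof.
have upper gn g (b : nat -> R) (e : R) : usc_dominated gn g ->
    {for x, continuous g} ->
    (forall n, ((b n)%:E <= usc_hull (gn n) x)%E) -> 0 < e ->
    \forall n \near \oo, b n <= g x + e.
  move=> gU gx bg e0.
  have /(usc_dominated_hull gU)[[A B] /= [xA ooB] AB] :
    (usc_hull g x < (g x + e)%:E)%E.
    by rewrite usc_hull_continuous// lte_fin ltrDl.
  apply: filterS ooB => n Bn; rewrite -lee_fin; apply: le_trans (bg n) _.
  by apply: (AB (x, n)); split=> //=; exact: nbhs_singleton.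
move=> [fU fL] fx afn; apply/cvgrPdist_le => e e0.
have aN n : ((- a n)%:E <= usc_hull (\- fn n)%R x)%E.
  by have /andP[+ _] := afn n; rewrite lsc_hullE leeNl EFinN.
have := upper _ _ a e fU fx (fun n => (andP (afn n)).2) e0.
have := upper _ _ (\- a) e fL (continuousN fx) aN e0; apply: filterS2 => n /= h1 h2.
rewrite ler_distlC; apply/andP; split.
  by rewrite -lerN2 opprB addrC.
by [].
Qed.

End HypiConvergence.

(** * Bounded convergence of p-th powers *)

Lemma cvg_powR_norm0 {R : realType} (u : nat -> R) (p : R) : 1 <= p ->
  u @ \oo --> 0 -> (fun n => `|u n| `^ p) @ \oo --> 0.
Proof.
move=> p1 /cvgr0Pnorm_le u0; apply/cvgr0Pnorm_le => e e0.
(* Once the norm of [u n] is at most 1, a power [p >= 1] only shrinks it; [u n = 0] is set apart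
   below. *)
apply: filterS2 (u0 _ e0) (u0 1 ltr01) => n ue u1.
rewrite ger0_norm ?powR_ge0//; apply: le_trans ue.
have [->|un0] := eqVneq (u n) 0.
  by rewrite normr0 powR0// gt_eqF// (lt_le_trans _ p1).
by apply: ge1r_powR => //; rewrite normr_gt0 un0 u1.
Qed.

Lemma bounded_convergence_powR d (T : measurableType d) (R : realType)
    (mu : {finite_measure set T -> \bar R}) (K : set T) (g : nat -> T -> R)
    (M p : R) : 1 <= p -> measurable K -> mu (~` K) = 0%E ->
  (forall n, measurable_fun setT (g n)) ->
  (\forall n \near \oo, forall x, K x -> `|g n x| <= M) ->
  {ae mu, forall x, g ^~ x @ \oo --> 0} ->
  (fun n => \int[mu]_x (`|g n x| `^ p)%:E)%E @ \oo --> 0%E.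
Proof.
move=> p1 mK muK mg [N _ gM] g0.
(* The bound [M] holds only from [N] on, hence the shift; the [p]-th power of [M] then dominates on
   [K], and is integrable because [mu] is finite. *)
rewrite -(cvg_shiftn N).
have [|||||_ _] := @dominated_convergence _ _ _ mu setT measurableT
  (fun n x => (`|g (n + N)%N x| `^ p)%:E) (cst 0%E) (EFin \o cst (M `^ p)).
- move=> n; apply/measurable_EFinP.
  apply: (measurableT_comp (measurable_powR p)).
  exact: measurableT_comp.
- exact: measurable_cst.
- apply: filterS g0 => x gx _ /=; apply: cvg_EFin; first exact: nearW.
  apply: (cvg_powR_norm0 p1).
  by rewrite (cvg_shiftn N (g ^~ x)).
- exact: finite_measure_integrable_cst.
- exists (~` K); split=> //; first exact: measurableC.
  apply: subsetC => x Kx n _ /=.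
  rewrite lee_fin ger0_norm ?powR_ge0// ge0_ler_powR ?nnegrE//.
  + exact: le_trans p1.
  + by apply: le_trans (gM N _ x Kx) => //=.
  + by apply: gM => //=; exact: leq_addl.
by rewrite integral0.
Qed.

Theorem proposition2p4 (R : realType) (T : pmetricType R)
    (T_lc : locally_compact [set: T]) (T_sep : separable T)
    (mu : {finite_measure set (borel T) -> \bar R})
    (mu_supp : exists2 K : set T, compact K & mu (~` K) = 0%E)
    (fn : nat -> T -> R) (f : T -> R)
    (fn_loc : forall n, linf_loc (fn n)) (f_loc : linf_loc f)
    (fn_f : hypi_cvg fn f)
    (f_cont : {ae mu, forall x : T, {for x, continuous f}})
    (p : R) (p_ge1 : 1 <= p) :
  (fun n => \int[mu]_x (`|usc_hull (fn n) x - lsc_hull (fn n) x| `^ p))%E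
    @ \oo --> 0%E
  /\
  forall (fns : nat -> T -> R) (fs : T -> R),
    (forall n, measurable_fun [set: borel T] (fns n)) ->
    measurable_fun [set: borel T] fs ->
    (forall n x, (lsc_hull (fn n) x <= (fns n x)%:E <= usc_hull (fn n) x)%E) ->
    (forall x, (lsc_hull f x <= (fs x)%:E <= usc_hull f x)%E) ->
    (fun n => \int[mu]_x ((`|fns n x - fs x| `^ p)%R)%:E)%E @ \oo --> 0%E.
Proof.
have [K cK muK] := mu_supp.
have mK : @measurable _ (borel T) K.
  rewrite -(setCK K); apply: measurableC; apply: sub_sigma_algebra.
  apply: closed_openC; apply: compact_closed cK.
  exact: (@metric_hausdorff R T).
have fnf := hypi_cvg_dominated fn_f.
have [M fnM] := hull_between_bounded T_lc f_loc fnf cK.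
have hle n x : (lsc_hull (fn n) x <= usc_hull (fn n) x)%E.
  exact: le_trans (lsc_hull_le (fn n) x) (usc_hull_ge (fn n) x).
(* The hulls are finite everywhere by local compactness and local boundedness, so they have
   real-valued versions. *)
pose u n x := fine (usc_hull (fn n) x).
pose l n x := fine (lsc_hull (fn n) x).
have uE n x : (u n x)%:E = usc_hull (fn n) x by rewrite fineK// usc_hull_fin.
have lE n x : (l n x)%:E = lsc_hull (fn n) x by rewrite fineK// lsc_hull_fin.
have ubt n x : (lsc_hull (fn n) x <= (u n x)%:E <= usc_hull (fn n) x)%E.
  by rewrite uE lexx hle.
have lbt n x : (lsc_hull (fn n) x <= (l n x)%:E <= usc_hull (fn n) x)%E.
  by rewrite lE lexx hle.
split=> [|fns fs mfns mfs fnsP fsP].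
  rewrite [X in X @ _](_ : _ =
      fun n => \int[mu]_x (`|u n x - l n x| `^ p)%:E)%E; last first.
    by apply/funext => n; apply: eq_integral => x _; rewrite -uE -lE.
  apply: (@bounded_convergence_powR _ (borel T) _ mu K _ (M + M)) => //.
  - move=> n; apply: measurable_funB; apply: measurableT_comp => //.
      exact: measurable_usc_hull.
    exact: measurable_lsc_hull.
  - apply: filterS fnM => n fnM x Kx.
    by apply: le_trans (ler_normB _ _) _; rewrite lerD// (fnM x).
  - apply: (@filterS _ _ (ae_filter_ringOfSetsType mu)) f_cont => x fx.
    rewrite -(subrr (f x)).
    by apply: cvgB; exact: (hull_between_cvg fnf fx).
(* The constant sequence [f] is dominated by [f], which bounds [fs] on [K]. *)
have [M' [N _ fsM]] :=
  hull_between_bounded T_lc f_loc (hypi_dominated_cst f) cK.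
apply: (@bounded_convergence_powR _ (borel T) _ mu K _ (M + M')) => //.
- by move=> n; exact: measurable_funB.
- apply: filterS fnM => n fnM x Kx.
  apply: le_trans (ler_normB _ _) _; apply: lerD; first exact: (fnM x).
  exact: (fsM N (leqnn N) x _ Kx (fsP x)).
- apply: (@filterS _ _ (ae_filter_ringOfSetsType mu)) f_cont => x fx.
  (* At a continuity point the two hulls of [f] coincide, which forces [fs x = f x]. *)
  have -> : 0 = f x - fs x.
    apply/esym/eqP; rewrite subr_eq0 eq_le -!lee_fin.
    by have := fsP x; rewrite lsc_hull_continuous// usc_hull_continuous.
  by apply: cvgB; [exact: (hull_between_cvg fnf fx)|exact: cvg_cst].
Qed.
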